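(* Let $C\subset\mathbb{S}^{n-1}$ be a spherical $2k$-design and let $y\in\mathbb{S}^{n-1}$ be a point which realizes the covering radius of $C$. Let $\ell$ be a real number with $-1<\ell<t_{k,1}$ and $P_{k+1}^{(n)}(\ell)\neq P_k^{(n)}(\ell)$. If $\ell\le t_1(y)$, then $$\rho(C)\ \ge\ t_{k,k}^{0,\ell},$$ where $t_{k,k}^{0,\ell}$ is the largest zero of the polynomial $P_k^{0,\ell}(t)$.
   Context: Here $n\ge 2$, $k\ge 1$ are integers. A finite set $C\subset\mathbb{S}^{n-1}\subset\mathbb{R}^n$ is a spherical $\tau$-design if for every polynomial $f(x_1,\dots,x_n)$ of degree at most $\tau$ the average of $f$ over $C$ equals the average of $f$ over $\mathbb{S}^{n-1}$ with respect to the (rotation-invariant) Lebesgue measure; it is assumed that $C$ spans $\mathbb{R}^n$. Covering radius: $d(y,C)=\min_{x\in C}d(y,x)$ (Euclidean distance), $r(C)=\max_{y\in\mathbb{S}^{n-1}}d(y,C)$, and $\rho(C):=1-\frac{r(C)^2}{2}=\min_{y\in\mathbb{S}^{n-1}}\max_{x\in C}\langle x,y\rangle$. A point $y\in\mathbb{S}^{n-1}$ realizes the covering radius if $\max_{x\in C}\langle x,y\rangle=\rho(C)$. For $y\in\mathbb{S}^{n-1}$ the multiset $\{\langle x,y\rangle:x\in C\}$ is written in order as $t_1(y)\le t_2(y)\le\cdots\le t_{|C|}(y)$. $P_i^{(n)}(t)$ are the Gegenbauer polynomials, normalized by $P_i^{(n)}(1)=1$ and orthogonal on $[-1,1]$ with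 respect to $d\mu(t)=c_n(1-t^2)^{(n-3)/2}dt$, where $c_n=\Gamma(n/2)/(\sqrt{\pi}\,\Gamma((n-1)/2))$ (so $\mu$ has total mass 1). $t_{i,1}<t_{i,2}<\cdots<t_{i,i}$ denote the zeros of $P_i^{(n)}$. For $\ell<t_{k,1}$ define the signed measure $d\mu_\ell(t)=-\frac{1}{\ell}(t-\ell)\,d\mu(t)$ on $[-1,1]$; it is positive definite up to degree $k-1$, i.e. $\int p^2\,d\mu_\ell>0$ for every nonzero real polynomial $p$ of degree at most $k-1$. For $0\le i\le k$, $P_i^{0,\ell}$ is the unique polynomial of degree $i$ that is orthogonal with respect to $d\mu_\ell$ to all polynomials of degree at most $i-1$ and satisfies $P_i^{0,\ell}(1)=1$. The zeros of $P_i^{0,\ell}$ are denoted $t_{i,1}^{0,\ell}<\cdots<t_{i,i}^{0,\ell}$. *)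

(* Defs.v *)
From HB Require Import structures.
From mathcomp Require Import all_boot all_order all_algebra.
From mathcomp Require Import finmap.
From mathcomp Require Import all_classical all_reals all_analysis.
From mathcomp.real_closed Require Import polyrcf.
(* The notations of mpoly clash with those of the analysis library. *)
From mathcomp Require Import -(notations) mpoly.

Set Implicit Arguments.
Unset Strict Implicit.
Unset Printing Implicit Defensive.

Import Order.TTheory GRing.Theory Num.Theory.
Import numFieldNormedType.Exports.

Local Open Scope classical_set_scope.
Local Open Scope ring_scope.

(* Points of R^n are row vectors. The norm `|x| that the library puts on
   'rV[R]_n is the sup norm, so Euclidean geometry is set up from the dot
   product. *)

Section Sphere.
Variables (R : realType) (n : nat).

Definition dot (x y : 'rV[R]_n) : R := \sum_(i < n) x 0 i * y 0 i.

Definition edist (x y : 'rV[R]_n) : R := Num.sqrt (dot (x - y) (x - y)).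

Definition sphere : set 'rV[R]_n := [set x | edist x 0 = 1].

Definition borel_rV := g_sigma_algebraType (@open 'rV[R]_n).

(* The normalized Lebesgue measure of the unit sphere, i.e. the
   rotation-invariant Borel probability measure carried by it (for n >= 2 there
   is exactly one), seen as a measure on R^n. *)
Definition is_sphere_measure (sigma : probability borel_rV R) : Prop :=
  sigma sphere = 1%E /\
  forall Q : 'M[R]_n, Q *m Q^T = 1%:M ->
  forall A : set borel_rV, measurable A ->
    sigma ((fun x : 'rV[R]_n => x *m Q) @^-1` A) = sigma A.

Definition evalmp (f : mpoly n R) (x : 'rV[R]_n) : R :=
  meval (fun i => x 0 i) f.

(* msize is the total degree plus one (and 0 for the zero polynomial). *)
Definition spherical_design (sigma : probability borel_rV R) (tau : nat)
    (C : {fset 'rV[R]_n}) : Prop :=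
  (forall x, x \in C -> sphere x) /\
  forall f : mpoly n R, (msize f <= tau.+1)%N ->
    (\sum_(x <- C) evalmp f x) / #|` C|%:R
      = \int[sigma]_(x in sphere) evalmp f x.

Definition spans (C : {fset 'rV[R]_n}) : Prop := (<< C >> = fullv)%VS.

(* Minima and maxima are written inf and sup: those over C range over a
   nonempty finite set, and the one over the sphere is attained. *)
Definition dist_to (C : {fset 'rV[R]_n}) (y : 'rV[R]_n) : R :=
  inf [set edist y x | x in [set` C]].

Definition covering_radius (C : {fset 'rV[R]_n}) : R :=
  sup [set dist_to C y | y in sphere].

Definition rho (C : {fset 'rV[R]_n}) : R := 1 - covering_radius C ^+ 2 / 2.

Definition max_dot (C : {fset 'rV[R]_n}) (y : 'rV[R]_n) : R :=
  sup [set dot x y | x in [set` C]].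

Definition realizes_covering_radius (C : {fset 'rV[R]_n}) (y : 'rV[R]_n) :
    Prop :=
  sphere y /\ max_dot C y = rho C.

(* t_i(y), with 1 <= i <= |C|. *)
Definition inner_value (C : {fset 'rV[R]_n}) (y : 'rV[R]_n) (i : nat) : R :=
  (sort <=%R [seq dot x y | x <- C])`_i.-1.

End Sphere.

Section OrthogonalPolynomials.
Variable R : realType.

Definition Gamma (s : R) : R :=
  \int[lebesgue_measure]_(t in `]0, +oo[) (t `^ (s - 1) * expR (- t)).

Definition gegenbauer_const (n : nat) : R :=
  Gamma (n%:R / 2) / (Num.sqrt pi * Gamma ((n%:R - 1) / 2)).

(* Integration against mu. At t = 1 and t = -1 the value of the density is
   immaterial. *)
Definition int_mu (n : nat) (f : R -> R) : R :=
  \int[lebesgue_measure]_(t in `[-1, 1])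
    (f t * (gegenbauer_const n * (1 - t ^+ 2) `^ ((n%:R - 3) / 2))).

(* Integration against the signed measure mu_l. *)
Definition int_mul (n : nat) (l : R) (f : R -> R) : R :=
  int_mu n (fun t => f t * (- l^-1 * (t - l))).

(* L is the integration functional f |-> \int f of a (signed) measure. *)
Definition is_orthogonal_poly (L : (R -> R) -> R) (i : nat) (p : {poly R}) :
    Prop :=
  [/\ size p = i.+1, p.[1] = 1 &
      forall q : {poly R}, (size q <= i)%N -> L (fun t => p.[t] * q.[t]) = 0].

Definition orthogonal_poly (L : (R -> R) -> R) (i : nat) : {poly R} :=
  xget 0 [set p | is_orthogonal_poly L i p].

(* P_i^(n) *)
Definition gegenbauer (n i : nat) : {poly R} := orthogonal_poly (int_mu n) i.

(* P_i^{0,l} *)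
Definition gegenbauer0 (n : nat) (l : R) (i : nat) : {poly R} :=
  orthogonal_poly (int_mul n l) i.

(* The j-th zero (j >= 1) in increasing order; rootsR is sorted and lists each
   root once. *)
Definition zero_of (p : {poly R}) (j : nat) : R := (rootsR p)`_j.-1.

End OrthogonalPolynomials.

(* Main.v *)
(* Let s be a zero of P = P_k^{0,l}, write P = (t - s) q, and suppose that all
   t = <x,y> with x in C are < s. Then f = (t - l) (t - s) q^2 has degree 2k and
   is <= 0 at these t, while the average of f(<x,y>) over C equals the integral
   of f dmu, a multiple of the integral of P q dmu_l, which is 0. Hence (t - l) q
   vanishes at all <x,y>, and so does its square; but the average of the square
   is the integral of a nonzero square against mu, which is positive. When
   zero_of takes its default value 0, the bound holds because the average of
   <x,y> over C is 0.

   The averages over the sphere and mu are related through their moments: both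
   satisfy (n + m) M_(m+2) = (m + 1) M_m, the first by rotation invariance, the
   second by integration by parts. *)

Require Import Defs.
From HB Require Import structures.
From mathcomp Require Import all_boot all_order all_algebra.
From mathcomp Require Import finmap.
From mathcomp Require Import all_classical all_reals all_analysis.
From mathcomp.real_closed Require Import polyrcf.
From mathcomp Require Import -(notations) mpoly.
From mathcomp Require Import measurable_realfun.
From mathcomp Require Import lra ring.

Set Implicit Arguments.
Unset Strict Implicit.
Unset Printing Implicit Defensive.

Import Order.TTheory GRing.Theory Num.Theory.
Import numFieldNormedType.Exports.

Local Open Scope classical_set_scope.
Local Open Scope ring_scope.

(** * Integrals over exhausted open sets *)

Section Exhaustion.
Variables (R : realType) (D : set R) (u v : R^nat).
Notation mu := (@lebesgue_measure R).
Notation I := (fun m => `[u m, v m]%classic).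
Hypotheses (oD : open D) (uv : forall m, u m < v m).
Hypotheses (ndI : nondecreasing_seq I) (bigI : \bigcup_m I m = D).

Let ID m : I m `<=` D.
Proof. by rewrite -bigI => x Ix; exists m. Qed.

Let ftc (f F : R -> R) m : {in D, continuous f} ->
  (forall x, D x -> is_derive x 1 F (f x)) ->
  (\int[mu]_(x in I m) (f x)%:E = (F (v m) - F (u m))%:E)%E.
Proof.
move=> cf dF.
have cF x : I m x -> {for x, continuous F}.
  by move=> /ID /dF dFx; apply/differentiable_continuous/derivable1_diffP/ex_derive.
rewrite (@continuous_FTC2 _ f F) ?EFinB//.
- apply: continuous_in_subspaceT => x /set_mem Ix.
  by apply: cf; apply/mem_set/(ID Ix).
- split.
  + by move=> x xI; have := dF x (ID (subset_itv_oo_cc xI)) => ?; exact: ex_derive.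
  + by apply: cvg_at_right_filter; apply: cF; rewrite /= in_itv/= lexx ltW.
  + by apply: cvg_at_left_filter; apply: cF; rewrite /= in_itv/= lexx ltW.
- move=> x xI; rewrite derive1E.
  by have := dF x (ID (subset_itv_oo_cc xI)) => ?; exact: derive_val.
Qed.

(** By the fundamental theorem of calculus the integrals over the compact [I m] are increments of F,
    hence at most 2M, and monotone convergence carries this bound to D. *)
Lemma integrable_bounded_primitive (f F : R -> R) (M : R) :
  {in D, continuous f} -> (forall x, D x -> 0 <= f x) ->
  (forall x, D x -> is_derive x 1 F (f x)) ->
  (forall x, D x -> `|F x| <= M) ->
  mu.-integrable D (EFin \o f).
Proof.
move=> cf f0 dF FM.
have mf : measurable_fun D f by exact: open_continuous_measurable_fun.
apply/integrableP; split; first exact/measurable_EFinP.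
have -> : (\int[mu]_(x in D) `|(EFin \o f) x| = \int[mu]_(x in D) (f x)%:E)%E.
  by apply: eq_integral => x /set_mem Dx /=; rewrite ger0_norm ?f0.
have cvI : (\int[mu]_(x in I m) (f x)%:E)%E @[m --> \oo] -->
    (\int[mu]_(x in D) (f x)%:E)%E.
  rewrite -bigI; apply: ge0_nondecreasing_set_cvg_integral => //.
    move=> m; apply/measurable_EFinP.
    by apply: (measurable_funS (open_measurable oD) (@ID m)).
  by move=> m x /ID Dx; rewrite lee_fin f0.
apply: (@le_lt_trans _ _ (M + M)%:E); last exact: ltry.
apply: (cvge_to_le cvI); apply: nearW => m.
rewrite (ftc m cf dF) lee_fin.
have um : I m (u m) by rewrite /= in_itv/= lexx ltW.
have vm : I m (v m) by rewrite /= in_itv/= lexx ltW.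
have := FM _ (ID um); have := FM _ (ID vm).
rewrite !ler_norml => /andP[? ?] /andP[? ?]; lra.
Qed.

(** The truncations of f to [I m] are dominated by |f|, so their integrals, which are increments of
    F, converge to the integral over D. *)
Lemma integral_primitive_cvg (f F : R -> R) (l : R) :
  {in D, continuous f} -> mu.-integrable D (EFin \o f) ->
  (forall x, D x -> is_derive x 1 F (f x)) ->
  F (v m) - F (u m) @[m --> \oo] --> l ->
  \int[mu]_(x in D) f x = l.
Proof.
move=> cf fi dF Fl.
have mD : measurable D by exact: open_measurable.
have mf : measurable_fun D f by exact: open_continuous_measurable_fun.
pose g m := (EFin \o f) \_ (I m).
have [|||||_ _] := @dominated_convergence _ _ _ mu D mD g (EFin \o f)
  (abse \o (EFin \o f)).
- move=> m; apply/measurable_restrict => //.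
  apply/measurable_EFinP; apply: (measurable_funS mD _ mf); exact: subIsetl.
- exact/measurable_EFinP.
- apply: aeW => x; rewrite -{1}bigI => -[N _ Nx].
  apply: cvg_near_cst; near=> m; rewrite /g patchE mem_set//.
  have : I N `<=` I m by rewrite -subsetEset; apply: ndI; near: m; exact: nbhs_infty_ge.
  exact.
- exact: integrable_abse.
- apply: aeW => x m _; rewrite /g patchE; case: ifP => //= _.
  by rewrite normr0 lee_fin.
have -> : [sequence \int[mu]_(x in D) g m x]_m%E = (fun m => (F (v m) - F (u m))%:E).
  apply/funext => m; rewrite -(ftc m cf dF) /= -integral_mkcondr; congr integral.
  by apply/setIidPr/ID.
move=> cvI; apply/esym.
have /fineK : (\int[mu]_(x in D) (EFin \o f) x)%E \is a fin_num.
  exact: integrable_fin_num.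
rewrite -/(Rintegral mu D f) => E; rewrite -E in cvI.
apply: (cvg_unique _ Fl) => //.
by move/fine_cvg: cvI.
Unshelve. all: by end_near. Qed.

End Exhaustion.

(** * The Gegenbauer weight *)

Section Weight.
Variable R : realType.
Notation mu := (@lebesgue_measure R).

(** As [harmonic m] is 1/(m+1), the halving keeps [rad 0] positive, so that every [- rad m, rad m]
    is a nondegenerate interval. *)
Definition rad (m : nat) : R := 1 - harmonic m / 2.

Lemma rad_itv m : 0 < rad m < 1.
Proof.
have : 0 < @harmonic R m by exact: harmonic_gt0.
have : @harmonic R m <= 1 by rewrite /harmonic/= invf_le1// ler1n.
by rewrite /rad => ? ?; apply/andP; split; lra.
Qed.

Lemma rad_cvg : rad m @[m --> \oo] --> (1 : R).
Proof.
rewrite -[X in _ --> X]subr0 -(mul0r 2^-1).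
apply: cvgB; first exact: cvg_cst.
by apply: cvgM; [exact: cvg_harmonic|exact: cvg_cst].
Qed.

Lemma rad_nondecreasing m m' : (m <= m')%N -> rad m <= rad m'.
Proof.
move=> mm'; rewrite /rad lerD2l lerN2 ler_pM2r// /harmonic /=.
by rewrite lef_pV2 ?posrE ?ltr0n// ler_nat ltnS.
Qed.

Lemma bigcup_rad : \bigcup_m `[- rad m, rad m]%classic = `]-1, 1[%classic :> set R.
Proof.
apply/seteqP; split => [x [m _]|x]; rewrite /= !in_itv/= => /andP[x1 x2].
  by have /andP[? ?] := rad_itv m; apply/andP; split; lra.
have e0 : 0 < 1 - `|x| by rewrite subr_gt0 ltr_norml x1.
have [m _ /(_ m (leqnn m)) mx] := near_infty_natSinv_lt (PosNum e0).
exists m => //=; rewrite in_itv/= -ler_norml /rad.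
have : 0 < @harmonic R m by exact: harmonic_gt0.
have : @harmonic R m < 1 - `|x| by exact: mx.
lra.
Qed.

(** The density of mu without the constant c_n. For n = 2 it is unbounded near the ends, hence the
    open interval below. *)
Definition weight (n : nat) (t : R) : R := (1 - t ^+ 2) `^ ((n%:R - 3) / 2).

Lemma one_sub_sqr_gt0 (t : R) : -1 < t < 1 -> 0 < 1 - t ^+ 2.
Proof. by move=> /andP[? ?]; nra. Qed.

Let itvE (t : R) : `]-1, 1[%classic t = (-1 < t < 1) :> Prop.
Proof. by rewrite /= in_itv. Qed.

Let is_derive_one_sub_sqr_powR (a t : R) : -1 < t < 1 ->
  is_derive t 1 (fun x => (1 - x ^+ 2) `^ a)
    (a * (1 - t ^+ 2) `^ (a - 1) * (- (2 * t))).
Proof.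
move=> /one_sub_sqr_gt0 t1.
have ? : is_derive t 1 (fun x : R => 1 - x ^+ 2) (- (2 * t)).
  have -> : (fun x : R => 1 - x ^+ 2) = cst 1 - (@id R) ^+ 2.
    by apply/funext => x; rewrite !fctE.
  by apply: is_derive_eq; rewrite sub0r expr1 -[_ *: _]/(_ * _) mulr1.
have := is_derive1_powR a t1 => ?.
exact: (@is_derive1_comp _ (fun y : R => y `^ a) (fun x : R => 1 - x ^+ 2)).
Qed.

Lemma weight_continuous n : {in `]-1, 1[%classic, continuous (weight n)}.
Proof.
move=> t /set_mem; rewrite itvE => t1.
have ? := is_derive_one_sub_sqr_powR ((n%:R - 3) / 2) t1.
exact/differentiable_continuous/derivable1_diffP/ex_derive.
Qed.

Lemma weight_gt0 n t : -1 < t < 1 -> 0 < weight n t.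
Proof. by move=> /one_sub_sqr_gt0 ?; exact: powR_gt0. Qed.

(** For n = 2 the weight is the derivative of arcsin, which is bounded by pi/2. *)
Lemma weight2_integrable : mu.-integrable `]-1, 1[ (EFin \o weight 2).
Proof.
apply: (@integrable_bounded_primitive _ _ (fun m => - rad m) rad _ _ _ _ _ asin (pi / 2)).
- exact: interval_open.
- by move=> m; have /andP[? ?] := rad_itv m; lra.
- move=> m m' mm'; rewrite subsetEset => x /=; rewrite !in_itv/= => /andP[? ?].
  by have := rad_nondecreasing mm'; move=> ?; apply/andP; split; lra.
- exact: bigcup_rad.
- exact: weight_continuous.
- by move=> t _; exact: powR_ge0.
- move=> t; rewrite itvE => t1; have := is_derive1_asin t1.
  rewrite -powR12_sqrt ?ltW ?one_sub_sqr_gt0// -powRN /weight.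
  by congr (is_derive _ _ _ (_ `^ _)); lra.
- move=> t; rewrite itvE => /andP[? ?]; rewrite ler_norml.
  by rewrite asin_lepi2 ?asin_geNpi2// !ltW.
Qed.

(** On ]-1, 1[ the base 1 - t^2 lies in ]0, 1], so a larger exponent gives a smaller power and the
    case n = 2 dominates. *)
Lemma weight_integrable n : (2 <= n)%N -> mu.-integrable `]-1, 1[ (EFin \o weight n).
Proof.
move=> n2; apply: le_integrable weight2_integrable => //.
  apply/measurable_EFinP; apply: open_continuous_measurable_fun; first exact: interval_open.
  exact: weight_continuous.
move=> t; rewrite itvE => t1 /=; rewrite lee_fin !ger0_norm ?powR_ge0//.
apply: ger_powR; first by rewrite one_sub_sqr_gt0//= gerBl sqr_ge0.
by rewrite ler_pM2r// lerD2r ler_nat.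
Qed.

Lemma horner_weight_integrable n (p : {poly R}) : (2 <= n)%N ->
  mu.-integrable `]-1, 1[ (EFin \o (fun t => p.[t] * weight n t)).
Proof.
move=> n2; apply: (@integrableMr _ _ _ mu `]-1, 1[ _ (horner p) (EFin \o weight n)).
- by [].
- by apply: measurable_funTS; apply: continuous_measurable_fun; exact: continuous_horner.
- have /compact_bounded[M [Mr HM]] : compact (horner p @` `[-1, 1]).
    apply: continuous_compact; last exact: segment_compact.
    by apply: continuous_subspaceT; exact: continuous_horner.
  exists M; split=> // x Mx t /= t1; apply: HM => //; exists t => //=.
  exact: subset_itv_oo_cc.
- exact: weight_integrable.
Qed.

(* The integrand is the derivative of p(t) (1 - t^2)^((n-1)/2). *)
Lemma integral_weight_divergence n (p : {poly R}) : (2 <= n)%N ->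
  \int[mu]_(t in `]-1, 1[)
    (((1 - 'X^2) * p^`() - (n%:R - 1) *: ('X * p)).[t] * weight n t) = 0.
Proof.
move=> n2; set q := _ - _.
pose a : R := (n%:R - 1) / 2.
have a0 : 0 < a by rewrite divr_gt0// subr_gt0 (ltr_nat _ 1).
pose G t := p.[t] * (1 - t ^+ 2) `^ a.
apply: (@integral_primitive_cvg _ _ (fun m => - rad m) rad _ _ _ _ _ G).
- exact: interval_open.
- by move=> m; have /andP[? ?] := rad_itv m; lra.
- move=> m m' mm'; rewrite subsetEset => x /=; rewrite !in_itv/= => /andP[? ?].
  by have := rad_nondecreasing mm'; move=> ?; apply/andP; split; lra.
- exact: bigcup_rad.
- move=> t t1; apply: cvgM; first exact: continuous_horner.
  exact: weight_continuous.
- exact: horner_weight_integrable.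
- move=> t; rewrite itvE => t1.
  have ? := is_derive_one_sub_sqr_powR a t1.
  apply: (is_derive_eq (is_deriveM _ _)).
  have -> : a - 1 = (n%:R - 3) / 2 by rewrite /a; field.
  rewrite -/(weight n t) /q !hornerE.
  have -> : (1 - t ^+ 2) `^ a = (1 - t ^+ 2) * weight n t.
    by rewrite /weight -mulr_powRB1 ?ltW ?one_sub_sqr_gt0//; congr (_ * _ `^ _); rewrite /a; field.
  by rewrite /a /GRing.scale/=; field.
(* The boundary terms vanish in the limit because the exponent a = (n-1)/2 is positive. *)
- have cvs : (1 - rad m ^+ 2) `^ a @[m --> \oo] --> (0 : R).
    move/cvg_at_rightP: (powR_cvg0 a0); apply; split.
      move=> m; have /andP[? ?] := rad_itv m; apply: one_sub_sqr_gt0.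
      by apply/andP; split; lra.
    have -> : (0 : R) = 1 - 1 ^+ 2 by rewrite expr1n subrr.
    by apply: cvgB; [exact: cvg_cst|rewrite expr2; apply: (cvgM rad_cvg rad_cvg)].
  have -> : (fun m => G (rad m) - G (- rad m)) =
      (fun m => (p.[rad m] - p.[- rad m]) * (1 - rad m ^+ 2) `^ a).
    by apply/funext => m; rewrite /G sqrrN mulrBl.
  have -> : (0 : R) = (p.[1] - p.[-1]) * 0 by rewrite mulr0.
  apply: cvgM => //.
  have cvp u c : u m @[m --> \oo] --> c -> p.[u m] @[m --> \oo] --> p.[c].
    by move=> uc; apply: (cvg_comp _ _ uc); exact: continuous_horner.
  by apply: cvgB; apply: cvp; [|apply: cvgN]; exact: rad_cvg.
Qed.

End Weight.

(** * Positivity of integrals and of the constant c_n *)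

Section Positivity.
Variable R : realType.
Notation mu := (@lebesgue_measure R).

(** If the integral were zero, f would vanish almost everywhere, and D would be covered by a null
    set and the countable zero set of f. *)
Lemma Rintegral_gt0 (D : set R) (f : R -> R) : measurable D -> (0 < mu D)%E ->
  mu.-integrable D (EFin \o f) -> (forall x, D x -> 0 <= f x) ->
  countable (D `&` [set x | f x = 0]) ->
  0 < \int[mu]_(x in D) f x.
Proof.
move=> mD D0 fi f0 cf; rewrite lt0r Rintegral_ge0// andbT.
apply: contraTN D0 => /eqP If0; rewrite -leNgt.
have : (\int[mu]_(x in D) `|(EFin \o f) x| = 0)%E.
  rewrite -[RHS]/(0%R%:E) -If0 /Rintegral fineK; last exact: integrable_fin_num.
  by apply: eq_integral => x /set_mem Dx /=; rewrite ger0_norm ?f0.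
move/(ae_eq_integral_abs mu mD (measurable_int _ fi)) => fae.
have nD : mu.-negligible D.
  apply: negligibleS (negligibleU fae _); last first.
    apply/negligibleP; last exact: (countable_lebesgue_measure0 cf).
    exact: countable_measurable.
  move=> x Dx; have [fx0|fx0] := eqVneq (f x) 0; first by right.
  by left => /(_ Dx) [] /eqP; rewrite (negbTE fx0).
by move/negligibleP : nD => ->.
Qed.

Let D : set R := `]0, +oo[%classic.

(** The derivative of arctan (sqrt t), of order t^(-1/2) at 0 and t^(-3/2) at infinity. *)
Let dom (t : R) := (2 * Num.sqrt t * (1 + t))^-1.

Let dom_integrable : mu.-integrable D (EFin \o dom).
Proof.
apply: (@integrable_bounded_primitive _ _ (fun m => m.+2%:R^-1) (fun m => m.+2%:R)
  _ _ _ _ _ (fun t => atan (Num.sqrt t)) (pi / 2)).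
- exact: interval_open.
- by move=> m; apply: (@lt_trans _ _ 1); rewrite ?invf_lt1 ?ltr0n ?ltr1n.
- move=> m m' mm'; rewrite subsetEset => x /=; rewrite !in_itv/= => /andP[? ?].
  have : m.+2%:R <= m'.+2%:R :> R by rewrite ler_nat !ltnS.
  have : m'.+2%:R^-1 <= m.+2%:R^-1 :> R.
    by rewrite lef_pV2 ?posrE ?ltr0n// ler_nat !ltnS.
  by move=> mV mm; rewrite (le_trans mV)// (le_trans _ mm).
- apply/seteqP; split => [x [m _]|x]; rewrite /D /= !in_itv/= => /andP[x0 x1].
    by rewrite andbT (lt_le_trans _ x0)// invr_gt0 ltr0n.
  have b1 := archi_boundP (ltW x0).
  have xV0 : 0 < x^-1 by rewrite invr_gt0.
  have b2 := archi_boundP (ltW xV0).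
  (* One summand puts x below m + 2, the other puts it above 1/(m + 2). *)
  exists (Num.bound x + Num.bound x^-1)%N => //=; rewrite in_itv/=; apply/andP; split.
    rewrite -[leRHS]invrK lef_pV2 ?posrE ?ltr0n//.
    by rewrite (le_trans (ltW b2))// ler_nat -addn2 -addnA addnCA leq_addr.
  by rewrite (le_trans (ltW b1))// ler_nat -addn2 -addnA leq_addr.
- move=> t /set_mem; rewrite /D/= in_itv/= andbT => t0.
  have ? := is_derive1_sqrt t0.
  apply: cvgV; first by rewrite !mulf_neq0 ?gt_eqF ?sqrtr_gt0 ?addr_gt0.
  apply: cvgM; last by apply: cvgD; [exact: cvg_cst|exact: cvg_id].
  apply: cvgM; first exact: cvg_cst.
  exact/differentiable_continuous/derivable1_diffP/ex_derive.
- move=> t; rewrite /D/= in_itv/= andbT => t0.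
  by rewrite invr_ge0 !mulr_ge0 ?sqrtr_ge0 ?addr_ge0 ?ltW.
- move=> t; rewrite /D/= in_itv/= andbT => t0.
  have ? := is_derive1_sqrt t0.
  have := is_derive1_atan (Num.sqrt t) => ?.
  apply: (is_derive_eq (is_derive1_comp _ _)).
  by rewrite sqr_sqrtr ?ltW// /dom -invfM mulrC.
- move=> t _; rewrite ger0_norm; first exact/ltW/atan_ltpi2.
  by rewrite -atan0 le_atan ?sqrtr_ge0.
Qed.

(* t^(s-1) e^-t <= C / (2 sqrt t (1 + t)), the derivative of C arctan (sqrt t). *)
Let Gamma_integrable (s : R) : 2^-1 <= s ->
  mu.-integrable D (EFin \o (fun t => t `^ (s - 1) * expR (- t))).
Proof.
move=> s2.
(* N exceeds s - 1/2, so t^(s-1/2) <= (1+t)^N. One term of the exponential series gives (1+t)^(N+1)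
   <= (N+1)! e^(1+t), which accounts for C; its factor 2 cancels the one in [dom]. *)
pose N := Num.bound (s - 2^-1).
pose C : R := 2 * (N.+1`!%:R * expR 1).
have iC : mu.-integrable D (fun t => C%:E * (EFin \o dom) t)%E.
  apply: integrableZl dom_integrable.
  by apply: open_measurable; exact: interval_open.
apply: le_integrable iC.
- by apply: open_measurable; exact: interval_open.
- apply/measurable_EFinP; apply: measurable_funM.
    by apply: measurable_funTS; apply: (measurableT_comp (measurable_powR _)).
  by apply: measurable_funTS; apply: measurableT_comp => //; exact: measurable_expR.
move=> t; rewrite /D/= in_itv/= andbT => t0; have t0' := ltW t0.
have t1 : 0 < 1 + t by rewrite addr_gt0.
have t1' := ltW t1; have st0 : 0 < Num.sqrt t by rewrite sqrtr_gt0.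
have s0 : 0 <= s - 2^-1 by rewrite subr_ge0.
have Cd0 : 0 <= C * dom t.
  by rewrite /C /dom !mulr_ge0 ?expR_ge0 ?invr_ge0 ?mulr_ge0 ?sqrtr_ge0.
rewrite lee_fin (ger0_norm Cd0) ger0_norm ?mulr_ge0 ?powR_ge0 ?expR_ge0//.
have -> : s - 1 = (s - 2^-1) - 2^-1 by field.
rewrite powRB; last by rewrite (gt_eqF t0) implybT.
rewrite powR12_sqrt//.
have pN : t `^ (s - 2^-1) <= (1 + t) ^+ N.
  rewrite -powR_mulrn//.
  apply: (@le_trans _ _ ((1 + t) `^ (s - 2^-1))).
    by apply: ge0_ler_powR; rewrite ?nnegrE ?lerDr.
  by apply: ler_powR; [rewrite lerDl|exact/ltW/archi_boundP].
have eN : (1 + t) ^+ N.+1 <= N.+1`!%:R * (expR 1 * expR t).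
  rewrite -expRD -ler_pdivrMl ?ltr0n ?fact_gt0// mulrC.
  by apply: le_trans (@expR_ge1Dxn _ (1 + t) N t1'); rewrite lerDr.
have et : expR t != 0 by rewrite gt_eqF ?expR_gt0.
have t1n : 1 + t != 0 by rewrite gt_eqF.
have stn : Num.sqrt t != 0 by rewrite gt_eqF.
have -> : C * dom t = (N.+1`!%:R * (expR 1 * expR t)) *
    ((1 + t)^-1 * (Num.sqrt t)^-1 * expR (- t)).
  by rewrite /C /dom expRN; field; rewrite et t1n stn.
have -> : t `^ (s - 2^-1) / Num.sqrt t * expR (- t) = t `^ (s - 2^-1) * (1 + t) *
    ((1 + t)^-1 * (Num.sqrt t)^-1 * expR (- t)).
  by field; rewrite t1n stn.
rewrite ler_wpM2r// ?mulr_ge0 ?invr_ge0 ?expR_ge0 ?sqrtr_ge0//.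
by apply: le_trans eN; rewrite exprSr ler_pM2r.
Qed.

(** The range s >= 1/2 covers n/2 and (n-1)/2 for n >= 2. Integrability rules out an infinite
    integral, which would be read as 0. *)
Lemma Gamma_gt0 (s : R) : 2^-1 <= s -> 0 < Gamma s.
Proof.
move=> s2; apply: Rintegral_gt0.
- by apply: open_measurable; exact: interval_open.
- by rewrite lebesgue_measure_itv/= ltry oppr0 adde0 ltry.
- exact: Gamma_integrable.
- by move=> t _; rewrite mulr_ge0 ?powR_ge0 ?expR_ge0.
- rewrite (_ : _ `&` _ = set0); last first.
    apply/seteqP; split => // t [] /=; rewrite in_itv/= andbT => t0 /eqP.
    by rewrite mulf_eq0 !gt_eqF ?expR_gt0 ?powR_gt0.
  exact: countable0.
Qed.

Lemma gegenbauer_const_gt0 n : (2 <= n)%N -> 0 < gegenbauer_const R n.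
Proof.
move=> n2; have n2' : 2 <= n%:R :> R by rewrite (ler_nat _ 2).
have s1 : 2^-1 <= n%:R / 2 :> R by rewrite -[leLHS]mul1r ler_pM2r//; lra.
have s2 : 2^-1 <= (n%:R - 1) / 2 :> R by rewrite -[leLHS]mul1r ler_pM2r//; lra.
by rewrite divr_gt0 ?Gamma_gt0// mulr_gt0 ?Gamma_gt0// sqrtr_gt0 pi_gt0.
Qed.

End Positivity.

(** * Moments of the Gegenbauer weight *)

Section Moments.
Variable R : realType.

Lemma mem_rootsR (p : {poly R}) (x : R) : p != 0 -> (x \in rootsR p) = root p x.
Proof. by move=> p0; rewrite -(roots_on_rootsR p0). Qed.

Lemma scalar_eq_on_monomials (L1 L2 : {poly R} -> R) (c : R) :
  scalar L1 -> scalar L2 -> (forall m, L1 'X^m = c * L2 'X^m) ->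
  forall p, L1 p = c * L2 p.
Proof.
have L0 (L : {poly R} -> R) : scalar L -> L 0 = 0.
  by move=> linL; have := linL (-1) 0 0; rewrite scaler0 addr0 mulN1r addNr.
move=> lin1 lin2 L12 p; rewrite -[p]coefK poly_def.
elim/big_rec: _ => [|i q _ IH]; first by rewrite !L0// mulr0.
by rewrite lin1 lin2 IH L12; ring.
Qed.

(* The identity L((1 - X^2) p' - (n - 1) X p) = 0, at the monomials p, reads
   (n + m) L(X^(m+2)) = (m + 1) L(X^m): this determines L up to a factor. *)
Lemma moments_eq (n : nat) (L1 L2 : {poly R} -> R) : (2 <= n)%N ->
  L1 'X = 0 -> L2 'X = 0 -> L2 1 = 1 ->
  (forall m, (n + m)%:R * L1 'X^(m.+2) = m.+1%:R * L1 'X^m) ->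
  (forall m, (n + m)%:R * L2 'X^(m.+2) = m.+1%:R * L2 'X^m) ->
  forall m, L1 'X^m = L1 1 * L2 'X^m.
Proof.
move=> n2 L1X L2X L21 rec1 rec2 m.
(* The recursion advances by two, so the induction carries two consecutive moments. *)
suff [] : L1 'X^m = L1 1 * L2 'X^m /\ L1 'X^(m.+1) = L1 1 * L2 'X^(m.+1) by [].
elim: m => [|m [IH1 IH2]]; first by rewrite expr0 expr1 L21 L1X L2X mulr1 mulr0.
split=> //; have nm : (n + m)%:R != 0 :> R by rewrite pnatr_eq0; case: n n2 {rec1 rec2}.
by apply: (mulfI nm); rewrite rec1 mulrCA rec2 IH1; ring.
Qed.

Notation mu := (@lebesgue_measure R).

Definition weight_integral n (p : {poly R}) : R :=
  \int[mu]_(t in `]-1, 1[) (p.[t] * weight n t).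

Lemma weight_integral_scalar n : (2 <= n)%N -> scalar (weight_integral n).
Proof.
move=> n2 a p q; rewrite /weight_integral -RintegralZl//; last exact: horner_weight_integrable.
rewrite -RintegralD//; first last.
- exact: horner_weight_integrable.
- have -> : (fun t => a * (p.[t] * weight n t)) = (fun t => (a *: p).[t] * weight n t).
    by apply/funext => t; rewrite hornerZ mulrA.
  exact: horner_weight_integrable.
- by apply: eq_Rintegral => t _; rewrite hornerD hornerZ; ring.
Qed.

Lemma weight_integral_gt0 n (p : {poly R}) : (2 <= n)%N ->
  p != 0 -> 0 < weight_integral n (p ^+ 2).
Proof.
move=> n2 p0; apply: Rintegral_gt0 => //.
- rewrite lebesgue_measure_itv/= lte_fin ifT; first by rewrite -EFinD lte_fin; lra.
  by lra.
- exact: horner_weight_integrable.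
- by move=> t _; rewrite mulr_ge0 ?powR_ge0// horner_exp sqr_ge0.
- apply: (@sub_countable _ _ _ [set` rootsR p]); last first.
    by apply: finite_set_countable; exact: finite_seq.
  apply: subset_card_le => t [] /=; rewrite in_itv/= => t1 /eqP.
  rewrite mulf_eq0 (gt_eqF (weight_gt0 n t1)) orbF horner_exp sqrf_eq0.
  by rewrite mem_rootsR.
Qed.

(** The divergence identity at p = 1 says that -(n-1) times this integral is 0. *)
Lemma weight_integralX n : (2 <= n)%N -> weight_integral n 'X = 0.
Proof.
move=> n2; have := integral_weight_divergence (1%:P : {poly R}) n2.

rewrite derivC polyC1 mulr0 sub0r mulr1 -/(weight_integral n _) -scaleNr.
rewrite -[X in weight_integral n X]addr0 weight_integral_scalar//.
have -> : weight_integral n 0 = 0.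
  rewrite /weight_integral (_ : (fun _ => _) = cst 0) ?Rintegral_cst ?mul0r//.
  by apply/funext => t; rewrite horner0 mul0r.
move/eqP; rewrite addr0 mulf_eq0 oppr_eq0 subr_eq0 (eqr_nat _ n 1) gtn_eqF//=.
by move/eqP.
Qed.

(** This is the divergence identity at p = X^(m+1). *)
Lemma weight_integral_rec n m : (2 <= n)%N ->
  (n + m)%:R * weight_integral n 'X^(m.+2) = m.+1%:R * weight_integral n 'X^m.
Proof.
move=> n2; have := integral_weight_divergence ('X^(m.+1) : {poly R}) n2.
rewrite -/(weight_integral n _).
have -> : (1 - 'X^2) * 'X^(m.+1)^`() - (n%:R - 1) *: ('X * 'X^(m.+1))
    = (- (n + m)%:R) *: 'X^(m.+2) + (m.+1%:R *: 'X^m + 0) :> {poly R}.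
  rewrite derivXn -mulr_natl -!mul_polyC !rmorphN !rmorphB /= !polyC_natr !exprS natrD.
  by rewrite -!polyC1; ring.
rewrite !weight_integral_scalar//.
have -> : weight_integral n 0 = 0.
  have := weight_integral_scalar n2 (-1) 0 0.
  by rewrite scaler0 addr0 mulN1r addNr.
by rewrite addr0 mulNr => /eqP; rewrite addrC subr_eq0 => /eqP.
Qed.

(** The endpoints of [-1, 1] are null, which reconciles the closed interval of [int_mu] with the
    open one. *)
Lemma int_mu_horner n (p : {poly R}) : (2 <= n)%N ->
  int_mu n (horner p) = gegenbauer_const R n * weight_integral n p.
Proof.
move=> n2; pose g t := p.[t] * weight n t.
have mg : measurable_fun [set: R] g.
  apply: measurable_funM; first by apply: continuous_measurable_fun; exact: continuous_horner.
  apply: (measurableT_comp (measurable_powR _)).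
  have -> : (fun t : R => 1 - t ^+ 2) = horner (1 - 'X^2).
    by apply/funext => t; rewrite !hornerE.
  by apply: continuous_measurable_fun; exact: continuous_horner.
rewrite /weight_integral -RintegralZl//; last exact: horner_weight_integrable.
rewrite /int_mu /Rintegral; congr fine.
have mcg : measurable_fun [set: R] (fun t => (gegenbauer_const R n * g t)%:E).
  by apply/measurable_EFinP; apply: measurable_funM.
rewrite -(integral_itv_bndoo true false); last exact: measurable_funTS.
by apply: eq_integral => t _; rewrite mulrCA.
Qed.

End Moments.

(** * Moments of the sphere measure *)

Section SphereMoments.
Variables (R : realType) (n : nat).
Implicit Types (x a b : 'rV[R]_n).

Lemma dotC a b : dot a b = dot b a.
Proof. by apply: eq_bigr => i _; rewrite mulrC. Qed.

Lemma dotDr x a b : dot x (a + b) = dot x a + dot x b.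
Proof. by rewrite -big_split; apply: eq_bigr => i _; rewrite mxE mulrDr. Qed.

Lemma dotZr c x a : dot x (c *: a) = c * dot x a.
Proof. by rewrite mulr_sumr; apply: eq_bigr => i _; rewrite mxE mulrCA. Qed.

Lemma dotBr x a b : dot x (a - b) = dot x a - dot x b.
Proof. by rewrite -scaleN1r dotDr dotZr mulN1r. Qed.

Lemma dotE x a : dot x a = (x *m a^T) 0 0.
Proof. by rewrite mxE; apply: eq_bigr => i _; rewrite mxE. Qed.

Lemma dot_mulmx x a (Q : 'M[R]_n) : dot (x *m Q) a = dot x (a *m Q^T).
Proof. by rewrite !dotE trmx_mul trmxK mulmxA. Qed.

Lemma dot_delta x i : dot x (delta_mx 0 i) = x 0 i.
Proof.
rewrite /dot (bigD1 i)//= mxE !eqxx mulr1 big1 ?addr0// => j ji.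
by rewrite mxE (negbTE ji) mulr0.
Qed.

Lemma dot_ge0 a : 0 <= dot a a.
Proof. by apply: sumr_ge0 => i _; rewrite -expr2 sqr_ge0. Qed.

Lemma dot_eq0 a : (dot a a == 0) = (a == 0).
Proof.
apply/eqP/eqP => [a0|->]; last by apply: big1 => i _; rewrite mxE mul0r.
apply/rowP => i; rewrite mxE; apply/eqP; rewrite -sqrf_eq0 expr2.
move/eqP: a0; rewrite psumr_eq0; last by move=> j _; rewrite -expr2 sqr_ge0.
by move/allP => /(_ i); rewrite mem_index_enum => /(_ isT).
Qed.

(* The Householder reflection along a - b. *)
Lemma exists_orthogonal a b : dot a a = dot b b ->
  exists2 Q : 'M[R]_n, Q *m Q^T = 1%:M & a *m Q^T = b.
Proof.
move=> ab; have [->|nab] := eqVneq a b.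
  by exists 1%:M; rewrite trmx1 mulmx1.
pose w := a - b; have w0 : dot w w != 0 by rewrite dot_eq0 subr_eq0.
have ww : dot w w = 2 * dot a w.
  rewrite /w !dotBr !(dotC (a - b)) !dotBr ab (dotC b a); ring.
(* P is symmetric and P^2 = |w|^2 P, so 1 - c P with c = 2 / |w|^2 is a symmetric involution. *)
pose P := w^T *m w.
have PT : P^T = P by rewrite trmx_mul trmxK.
have PP : P *m P = dot w w *: P.
  rewrite /P mulmxA -(mulmxA _ w) [w *m w^T]mx11_scalar -dotE.
  by rewrite mul_mx_scalar -scalemxAl.
pose c := 2 / dot w w.
have QT : (1%:M - c *: P)^T = 1%:M - c *: P.
  by rewrite [LHS]linearB [X in _ - X]linearZ /= trmx1 PT.
exists (1%:M - c *: P); rewrite QT.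
  rewrite mulmxBl mul1mx mulmxBr mulmx1 -scalemxAl -scalemxAr PP.
  rewrite !scalerA.
  have -> : c * c * dot w w = c + c by rewrite /c; field.
  by rewrite scalerDl opprD opprK addKr subrK.
rewrite mulmxBr mulmx1 -scalemxAr mulmxA [a *m w^T]mx11_scalar -dotE.
rewrite mul_scalar_mx scalerA.
(* Equal lengths of a and b gave |w|^2 = 2 <a, w>, so a is sent to a - w = b. *)
have -> : c * dot a w = 1 by rewrite /c ww; field; move: w0; rewrite ww mulf_eq0 negb_or => /andP[].
by rewrite scale1r subKr.
Qed.

Lemma sphereE x : sphere x = (dot x x = 1) :> Prop.
Proof.
rewrite -[sphere x]/(Num.sqrt (dot (x - 0) (x - 0)) = 1) subr0.
apply/propext; split => [H|->]; last exact: sqrtr1.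
by rewrite -[LHS]sqr_sqrtr ?dot_ge0// H expr1n.
Qed.

Lemma sphere_coord_le1 x i : sphere x -> `|x 0 i| <= 1.
Proof.
rewrite sphereE => x1; rewrite -(@ler_pXn2r _ 2)// ?nnegrE// expr1n real_normK ?num_real//.
by rewrite -x1 /dot (bigD1 i)//= -expr2 lerDl sumr_ge0// => j _; rewrite -expr2 sqr_ge0.
Qed.

Lemma sphere_dot_le a x : sphere x -> `|dot x a| <= \sum_i `|a 0 i|.
Proof.
move=> xS; apply: (le_trans (ler_norm_sum _ _ _)); apply: ler_sum => i _.
by rewrite normrM ler_piMl// sphere_coord_le1.
Qed.

Lemma measurable_coord i :
  measurable_fun [set: borel_rV R n] (fun x : borel_rV R n => (x : 'rV[R]_n) 0 i).
Proof.
apply: (measurability _ (RGenOpens.measurableE R)).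
move=> _ [_ [a [b ->] <-]]; rewrite setTI; apply: sub_sigma_algebra.
apply: open_comp; last exact: interval_open.
by move=> x _; exact: coord_continuous.
Qed.

(** Made a measurable function below, so that [distribution sigma (dotr a)] is the law of <x, a>. *)
Definition dotr a (x : borel_rV R n) : R := dot (x : 'rV[R]_n) a.

Lemma measurable_dotr a : measurable_fun [set: borel_rV R n] (dotr a).
Proof.
apply: measurable_sum => i; apply: measurable_funM => //.
exact: measurable_coord.
Qed.

HB.instance Definition _ a := isMeasurableFun.Build _ _ _ _ (dotr a) (measurable_dotr a).

Lemma measurable_sphere : measurable (@sphere R n : set (borel_rV R n)).
Proof.
have md : measurable_fun [set: borel_rV R n] (fun x : borel_rV R n => dot (x : 'rV[R]_n) (x : 'rV[R]_n)).
  by apply: measurable_sum => i; apply: measurable_funM; exact: measurable_coord.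
have -> : @sphere R n = [set: borel_rV R n] `&` (fun x => dot x x) @^-1` [set 1].
  by apply/seteqP; split => x; rewrite setTI /= -sphereE.
exact: md.
Qed.

Variables (sigma : probability (borel_rV R n) R) (hsigma : is_sphere_measure sigma).

Lemma sphere_integrable (f : 'rV[R]_n -> R) (M : R) :
  measurable_fun [set: borel_rV R n] f -> (forall x, sphere x -> `|f x| <= M) ->
  sigma.-integrable (@sphere R n) (EFin \o f).
Proof.
move=> mf fM; apply: measurable_bounded_integrable.
- exact: measurable_sphere.
- by apply: (@le_lt_trans _ _ 1%E); [exact: probability_le1 measurable_sphere|exact: ltry].
- exact: measurable_funTS.
- by exists M; split; [exact: num_real|move=> r Mr x /= /fM /le_trans; apply; exact: ltW].
Qed.

(** The complement of the sphere is null, so the integral extends to the whole space, where it is an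
    expectation under the law of <x, a>. *)
Lemma sphere_integral_distribution (h : R -> R) a : measurable_fun [set: R] h ->
  sigma.-integrable (@sphere R n) (EFin \o (h \o dotr a)) ->
  \int[sigma]_(x in @sphere R n) h (dot x a)
    = \int[distribution sigma (dotr a)]_t h t.
Proof.
move=> mh ih; rewrite /Rintegral; congr fine.
have sC0 : sigma (~` @sphere R n) = 0%E.
  have s1 : sigma (@sphere R n) = 1%E by exact: hsigma.1.
  by rewrite probability_setC ?s1 ?subee//; exact: measurable_sphere.
have mh' : measurable_fun [set: borel_rV R n] (EFin \o (h \o dotr a)).
  by apply/measurable_EFinP; exact: (measurableT_comp mh (measurable_dotr a)).
have mSC : measurable (~` @sphere R n : set (borel_rV R n)).
  by apply: measurableC; exact: measurable_sphere.
have iT : sigma.-integrable setT (EFin \o (h \o dotr a)).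
  apply/(@negligible_integrable _ _ _ sigma setT (~` @sphere R n)) => //.
  by rewrite setTD setCK.
rewrite integral_distribution//; last exact/measurable_EFinP.
rewrite [RHS](@negligible_integral _ _ _ sigma setT (~` @sphere R n))//.
by rewrite setTD setCK.
Qed.

(** An orthogonal matrix carries a to b, so <x, a> and <x, b> have the same law. *)
Lemma sphere_integral_rotate (h : R -> R) a b : measurable_fun [set: R] h ->
  sigma.-integrable (@sphere R n) (EFin \o (h \o dotr a)) ->
  sigma.-integrable (@sphere R n) (EFin \o (h \o dotr b)) ->
  dot a a = dot b b ->
  \int[sigma]_(x in @sphere R n) h (dot x a)
    = \int[sigma]_(x in @sphere R n) h (dot x b).
Proof.
move=> mh ia ib /exists_orthogonal[Q QQ aQ]; rewrite !sphere_integral_distribution//.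
rewrite /Rintegral; congr fine; apply: eq_measure_integral => A mA _.
rewrite /= /distribution /pushforward -aQ -[LHS](hsigma.2 Q QQ).
  by congr (sigma _); apply/seteqP; split => x /=; rewrite /dotr dot_mulmx.
by rewrite -[X in measurable X]setTI; exact: measurable_dotr.
Qed.

End SphereMoments.

(** * Auxiliary facts on finite sums of integrals and on polynomials *)

Lemma Rintegral_sum d (T : measurableType d) (R : realType)
    (mu : {measure set T -> \bar R}) (D : set T) (I : Type) (s : seq I)
    (P : pred I) (f : I -> T -> R) : measurable D ->
  (forall i, mu.-integrable D (EFin \o f i)) ->
  \int[mu]_(x in D) (\sum_(i <- s | P i) f i x)
    = \sum_(i <- s | P i) \int[mu]_(x in D) f i x.
Proof.
move=> mD fi; have int_sum t : mu.-integrable D (EFin \o (fun x => \sum_(i <- t | P i) f i x)).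
  rewrite (_ : _ \o _ = fun x => (\sum_(i <- t | P i) (EFin \o f i) x)%E).
    exact: integrable_sum.
  by apply/funext => x /=; rewrite sumEFin.
elim: s => [|i s IH].
  under eq_Rintegral do rewrite big_nil.
  by rewrite Rintegral_cst// mul0r big_nil.
under eq_Rintegral do rewrite big_cons.
by rewrite big_cons; case: ifP => // _; rewrite RintegralD// IH.
Qed.

(** In characteristic zero the natural numbers supply more roots of p - q than its degree allows. *)
Lemma poly_ext (R : numDomainType) (p q : {poly R}) : horner p =1 horner q -> p = q.
Proof.
move=> pq; apply/eqP; rewrite -subr_eq0; apply/negPn/negP => pq0.
pose rs : seq R := [seq i%:R | i <- iota 0 (size (p - q))].
have : (size rs < size (p - q)%R)%N.
  apply: max_poly_roots => //.
    by apply/allP => x _; rewrite rootE hornerD hornerN pq subrr.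
  by rewrite map_inj_uniq ?iota_uniq//; exact/mulrIn/oner_neq0.
by rewrite size_map size_iota ltnn.
Qed.

(** Serves to read off a T^2 coefficient below; the constant term is included because the induction
    on N needs it. *)
Lemma coef2_expr1DXn (R : comNzRingType) N :
  ((1 + 'X^2) ^+ N : {poly R})`_0 = 1 /\ ((1 + 'X^2) ^+ N : {poly R})`_2 = N%:R.
Proof.
elim: N => [|N [IH0 IH2]]; first by rewrite expr0 !coef1.
rewrite exprS mulrDl mul1r !coefD !coefXnM /= IH0 IH2 addr0; split=> //.
by rewrite -natr1.
Qed.

(** * Moments of <x, a> and their recursion *)

Section ZonalMoments.
Variables (R : realType) (n : nat).
Implicit Types (x a b : 'rV[R]_n) (p q : {poly R}).
Variables (sigma : probability (borel_rV R n) R) (hsigma : is_sphere_measure sigma).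
Notation S := (@sphere R n : set (borel_rV R n)).
Notation E f := (\int[sigma]_(x in S) f x).

Let mS : measurable S. Proof. exact: measurable_sphere. Qed.

Lemma sphere_horner_bound p a : exists M, forall x, sphere x -> `|p.[dot x a]| <= M.
Proof.
pose K := \sum_i `|a 0 i|.
have /compact_bounded[M [Mr HM]] : compact (horner p @` `[- K, K]).
  apply: continuous_compact; last exact: segment_compact.
  by apply: continuous_subspaceT; exact: continuous_horner.
exists (M + 1) => x xS; apply: (HM (M + 1)); first by rewrite ltrDl.
by exists (dot x a) => //=; rewrite in_itv/= -ler_norml sphere_dot_le.
Qed.

Lemma measurable_horner_dot p a :
  measurable_fun [set: borel_rV R n] (fun x : borel_rV R n => p.[dot (x : 'rV[R]_n) a]).
Proof.
apply: (measurableT_comp _ (measurable_dotr a)).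
by apply: continuous_measurable_fun; exact: continuous_horner.
Qed.

Lemma horner_dotM_integrable p a q b :
  sigma.-integrable S (EFin \o (fun x => p.[dot x a] * q.[dot x b])).
Proof.
have [M1 H1] := sphere_horner_bound p a; have [M2 H2] := sphere_horner_bound q b.
apply: (sphere_integrable sigma (M := M1 * M2)).
  by apply: measurable_funM; exact: measurable_horner_dot.
by move=> x xS; rewrite normrM ler_pM ?normr_ge0 ?H1 ?H2.
Qed.

Lemma horner_dot_integrable p a : sigma.-integrable S (EFin \o (fun x => p.[dot x a])).
Proof.
have := horner_dotM_integrable p a 1 a; congr (_.-integrable _ _).
by apply/funext => x /=; rewrite hornerC mulr1.
Qed.

Lemma zonal_rotate p a b : dot a a = dot b b ->
  E (fun x => p.[dot x a]) = E (fun x => p.[dot x b]).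
Proof.
apply: (sphere_integral_rotate hsigma (h := horner p)).
- by apply: continuous_measurable_fun; exact: continuous_horner.
- exact: horner_dot_integrable.
- exact: horner_dot_integrable.
Qed.

Lemma expr_dotM_integrable i j a b :
  sigma.-integrable S (EFin \o (fun x => dot x a ^+ i * dot x b ^+ j)).
Proof.
have := horner_dotM_integrable 'X^i a 'X^j b; congr (_.-integrable _ _).
by apply/funext => x /=; rewrite !hornerXn.
Qed.

Lemma expr_dot_integrable i a : sigma.-integrable S (EFin \o (fun x => dot x a ^+ i)).
Proof.
have := horner_dot_integrable 'X^i a; congr (_.-integrable _ _).
by apply/funext => x /=; rewrite !hornerXn.
Qed.

Lemma expr_dot_rotate m a b : dot a a = dot b b ->
  E (fun x => dot x a ^+ m) = E (fun x => dot x b ^+ m).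
Proof.
move=> ab; have := zonal_rotate 'X^m ab.
by congr (_ = _); apply: eq_Rintegral => x _; rewrite hornerXn.
Qed.

(** Rotating a to -a shows that the moment equals its own negative. *)
Lemma odd_moment m a : odd m -> E (fun x => dot x a ^+ m) = 0.
Proof.
move=> om; have aa : dot a a = dot (- a) (- a).
  by apply: eq_bigr => i _; rewrite mxE mulrNN.
have := expr_dot_rotate m aa.
have -> : E (fun x => dot x (- a) ^+ m) = - E (fun x => dot x a ^+ m).
  rewrite -mulN1r -RintegralZl//; last exact: expr_dot_integrable.
  apply: eq_Rintegral => x _; rewrite -scaleN1r dotZr exprMn -signr_odd om.
  by rewrite expr1.
lra.
Qed.

(* The coefficient of T^2 in E[(x.a + T x.b)^(2j+2)] = (1+T^2)^(j+1) E[(x.a)^(2j+2)],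
   which is rotation invariance along the vectors a + T b. *)
Lemma mixed_moment j a b : dot a a = 1 -> dot b b = 1 -> dot a b = 0 ->
  j.*2.+1%:R * E (fun x => dot x a ^+ j.*2 * dot x b ^+ 2)
    = E (fun x => dot x a ^+ j.*2.+2).
Proof.
move=> aa bb ab; set m := j.*2.+2; set M := E (fun x => dot x a ^+ m).
pose e i := E (fun x => dot x a ^+ (m - i) * dot x b ^+ i).
(* P(T) is E[(x.a + T x.b)^m] expanded by the binomial theorem. *)
pose P : {poly R} := \poly_(i < m.+1) (e i *+ 'C(m, i)).
have PQ : P = M *: (1 + 'X^2) ^+ j.+1.
  apply: poly_ext => T; rewrite horner_poly hornerZ horner_exp !hornerE.
  (* As a and b are orthonormal, a + T b has the same length as s a. *)
  pose s := Num.sqrt (1 + T ^+ 2).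
  have s2 : s ^+ 2 = 1 + T ^+ 2 by rewrite sqr_sqrtr// addr_ge0 ?sqr_ge0.
  have cc : dot (a + T *: b) (a + T *: b) = dot (s *: a) (s *: a).
    rewrite !dotDr !dotZr !(dotC (a + _)) !(dotC (s *: a)) !dotDr !dotZr aa bb (dotC b a) ab.
    by rewrite !mulr1 -[RHS]expr2 s2; ring.
  have <- : E (fun x => dot x (s *: a) ^+ m) = M * (1 + T ^+ 2) ^+ j.+1.
    rewrite -s2 -exprM mul2n doubleS -/m mulrC -RintegralZl//; last exact: expr_dot_integrable.
    by apply: eq_Rintegral => x _; rewrite dotZr exprMn.
  rewrite -(expr_dot_rotate _ cc).
  transitivity (E (fun x => \sum_(i < m.+1) (T ^+ i *+ 'C(m, i)) *
     (dot x a ^+ (m - i) * dot x b ^+ i))).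
    rewrite Rintegral_sum//.
      apply: eq_bigr => i _; rewrite RintegralZl//; last exact: expr_dotM_integrable.
      by rewrite -/(e i) mulrnAl mulrnAl [T ^+ i * _]mulrC.
    move=> i; have := integrableZl mS (T ^+ i *+ 'C(m, i)) (expr_dotM_integrable (m - i) i a b).
    by congr (_.-integrable _ _).
  apply: eq_Rintegral => x _; rewrite dotDr dotZr exprDn.
  by apply: eq_bigr => i _; rewrite exprMn mulrnAl mulrCA.
(* This reads binom(2j+2, 2) E[(x.a)^(2j) (x.b)^2] = (j+1) M; the binomial is (j+1)(2j+1), and j+1
   cancels. *)
have : P`_2 = (M *: (1 + 'X^2) ^+ j.+1)`_2 by rewrite PQ.
rewrite coef_poly /m /= coefZ (coef2_expr1DXn R j.+1).2 /e subSS subSS subn0.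
move=> H; have j0 : j.+1%:R != 0 :> R by rewrite pnatr_eq0.
apply: (mulIf j0); rewrite -H -[RHS]mulr_natr mulrAC [LHS]mulrC; congr (_ * _).
rewrite -natrM; congr (_%:R); rewrite bin2 -doubleS.
by rewrite -doubleMl doubleK mulnC.
Qed.

(** For odd m both sides vanish. For m = 2j, squared coordinates sum to 1 on the sphere, so
    x_i0^(2j) (1 - x_i0^2) is a sum of n-1 mixed terms, each of mean M_(2j+2) / (2j+1). *)
Lemma moment_rec (i0 : 'I_n) m :
  (n + m)%:R * E (fun x => dot x (delta_mx 0 i0) ^+ m.+2)
    = m.+1%:R * E (fun x => dot x (delta_mx 0 i0) ^+ m).
Proof.
have [om|em] := boolP (odd m).
  by rewrite !odd_moment ?mulr0//= negbK.
rewrite -(odd_double_half m) (negbTE em) add0n; set j := m./2.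
pose u i : 'rV[R]_n := delta_mx 0 i.
have uu i k : dot (u i) (u k) = (i == k)%:R.
  by rewrite dot_delta mxE eqxx /= eq_sym.
pose M k := E (fun x => dot x (u i0) ^+ k).
have sumE : \sum_(i | i != i0) E (fun x => dot x (u i0) ^+ j.*2 * dot x (u i) ^+ 2)
    = M j.*2 - M j.*2.+2.
  rewrite -Rintegral_sum//; last by move=> i; exact: expr_dotM_integrable.
  rewrite -RintegralB//; [|exact: expr_dot_integrable..].
  apply: eq_Rintegral => x /set_mem xS; rewrite -mulr_sumr -(addn2 j.*2) exprD.
  rewrite -[X in X - _]mulr1 -mulrBr; congr (_ * _).
  have : \sum_i dot x (u i) ^+ 2 = 1.
    move: xS; rewrite sphereE => <-; apply: eq_bigr => i _.
    by rewrite dot_delta expr2.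
  rewrite (bigD1 i0)//= => sum1.
  by apply: (addrI (dot x (u i0) ^+ 2)); rewrite sum1 addrC subrK.
have : j.*2.+1%:R * (M j.*2 - M j.*2.+2) = (n%:R - 1) * M j.*2.+2.
  rewrite -sumE mulr_sumr.
  rewrite (eq_bigr (fun=> M j.*2.+2)); last first.
    move=> i ii0; rewrite mixed_moment ?uu ?eqxx//.
    by rewrite eq_sym (negbTE ii0).
  rewrite sumr_const -[LHS]mulr_natl. congr (_ * _).
  have := cardC1 i0; rewrite card_ord => ->.
  have n0 : (0 < n)%N by exact: leq_ltn_trans (ltn_ord i0).
  by rewrite -[in RHS](prednK n0) -[in RHS]natr1 addrK.
rewrite -/(M _) -/(M j.*2) natrD -natr1 => H; lra.
Qed.

End ZonalMoments.

(** * Zonal means: comparison with mu, and averages over designs *)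

Section Zonal.
Variables (R : realType) (n : nat) (sigma : probability (borel_rV R n) R).
Hypotheses (n2 : (2 <= n)%N) (hsigma : is_sphere_measure sigma).

Definition zonal_mean (y : 'rV[R]_n) (p : {poly R}) : R :=
  \int[sigma]_(x in (@sphere R n : set (borel_rV R n))) p.[dot x y].

Lemma zonal_mean_scalar y : scalar (zonal_mean y).
Proof.
move=> a p q; rewrite /zonal_mean.
have mS := @measurable_sphere R n.
rewrite -RintegralZl//; last exact: horner_dot_integrable.
rewrite -RintegralD//; last 2 first.
- have := horner_dot_integrable sigma (a *: p) y; congr (_.-integrable _ _).
  by apply/funext => x /=; rewrite hornerZ.
- exact: horner_dot_integrable.
by apply: eq_Rintegral => x _; rewrite hornerD hornerZ.
Qed.

Lemma zonal_mean1 y : zonal_mean y 1 = 1.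
Proof.
rewrite /zonal_mean (_ : (fun _ => _) = cst 1); last by apply/funext => x; rewrite hornerC.
by rewrite Rintegral_cst ?mul1r ?[X in fine X]hsigma.1//; exact: measurable_sphere.
Qed.

(** Both functionals are linear, vanish at X and satisfy the same moment recursion, hence are
    proportional; p = 1 gives the factor. *)
Lemma weight_integral_zonal_mean y p : sphere y ->
  weight_integral n p = weight_integral n 1 * zonal_mean y p.
Proof.
move=> yS; pose i0 := Ordinal (ltnW n2).
(* Rotating y to a coordinate vector makes [moment_rec] applicable. *)
have zE q : zonal_mean y q = zonal_mean (delta_mx 0 i0) q.
  apply: zonal_rotate => //; rewrite dot_delta mxE !eqxx.
  by move: yS; rewrite sphereE.
have zX m : zonal_mean y 'X^m
    = \int[sigma]_(x in (@sphere R n : set (borel_rV R n))) dot x (delta_mx 0 i0) ^+ m.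
  by rewrite zE; apply: eq_Rintegral => x _; rewrite hornerXn.
apply: (scalar_eq_on_monomials (weight_integral_scalar n2) (zonal_mean_scalar y)).
apply: (@moments_eq _ n) => //.
- exact: weight_integralX.
- by rewrite -['X]expr1 zX odd_moment.
- exact: zonal_mean1.
- by move=> m; exact: weight_integral_rec.
- by move=> m; rewrite !zX moment_rec.
Qed.

Lemma weight_integral1_gt0 : 0 < weight_integral n (1 : {poly R}).
Proof. by have := weight_integral_gt0 n2 (oner_neq0 {poly R}); rewrite expr1n. Qed.

(** The two functionals differ by a positive factor, so orthogonality for mu can be tested by sphere
    averages. *)
Lemma int_mu_eq0 y p : sphere y ->
  (int_mu n (horner p) == 0) = (zonal_mean y p == 0).
Proof.
move=> yS; rewrite int_mu_horner// (weight_integral_zonal_mean p yS).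
by rewrite mulf_eq0 (gt_eqF (gegenbauer_const_gt0 R n2)) mulf_eq0 (gt_eqF weight_integral1_gt0).
Qed.

Lemma zonal_mean_sqr_gt0 y p : sphere y -> p != 0 -> 0 < zonal_mean y (p ^+ 2).
Proof.
move=> yS p0; have := weight_integral_gt0 n2 p0.
by rewrite (weight_integral_zonal_mean _ yS) pmulr_rgt0 ?weight_integral1_gt0.
Qed.

Lemma zonal_mean_opp y p : zonal_mean y (p \Po - 'X) = zonal_mean y p.
Proof.
have yy : dot y y = dot (- y) (- y) by apply: eq_bigr => i _; rewrite !mxE mulrNN.
rewrite [RHS](zonal_rotate hsigma p yy); apply: eq_Rintegral => x _.
by rewrite horner_comp hornerN hornerX -(scaleN1r y) dotZr mulN1r.
Qed.

Lemma msize_exp_linear (y : 'rV[R]_n) i :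
  (msize ((\sum_j y 0 j *: mpolyX R (mnm1 j)) ^+ i) <= i.+1)%N.
Proof.
(* The case L = 0 is separate because the size formula for products requires nonzero factors. *)
set L := \sum_j _; have [->|L0] := eqVneq L 0.
  by case: i => [|i]; rewrite ?expr0 ?msize1// exprS mul0r msize0.
have L2 : (msize L <= 2)%N.
  apply: (leq_trans (msize_sum _ _ _)); apply/bigmax_leqP => j _.
  by rewrite (leq_trans (msizeZ_le _ _))// msizeX mdeg1.
elim: i => [|i IH]; first by rewrite expr0 msize1.
rewrite exprS msizeM ?expf_neq0//.
by rewrite -subn1 leq_subLR; exact: leq_add L2 IH.
Qed.

(** Substituting the linear form <x, y> into p gives a polynomial in the coordinates of x of degree
    at most that of p. Here [k] is the strength of the design, later [2 * k]. *)
Lemma design_mean (k : nat) (C : {fset 'rV[R]_n}) (y : 'rV[R]_n) (p : {poly R}) :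
  spherical_design sigma k C -> (size p <= k.+1)%N ->
  (\sum_(x <- C) p.[dot x y]) / #|` C|%:R = zonal_mean y p.
Proof.
move=> [_ hC] pk.
pose L : mpoly n R := \sum_j y 0 j *: mpolyX R (mnm1 j).
pose f : mpoly n R := \sum_(i < size p) p`_i *: L ^+ i.
have fE x : evalmp f x = p.[dot x y].
  rewrite /evalmp /f raddf_sum /= horner_coef; apply: eq_bigr => i _.
  rewrite mevalZ rmorphXn /= /L raddf_sum /=; congr (_ * _ ^+ _).
  by apply: eq_bigr => j _; rewrite mevalZ mevalXU mulrC.
have fk : (msize f <= k.+1)%N.
  apply: (leq_trans (msize_sum _ _ _)); apply/bigmax_leqP => i _.
  rewrite (leq_trans (msizeZ_le _ _))// (leq_trans (msize_exp_linear y i))//.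
  by rewrite (leq_trans (ltn_ord i)).
rewrite (eq_bigr (evalmp f)); last by move=> x _; rewrite fE.
by rewrite hC//; apply: eq_Rintegral => x _; rewrite fE.
Qed.

End Zonal.

(** * Designs *)

Section DesignInequality.
Variables (R : realType) (n k : nat) (sigma : probability (borel_rV R n) R).
Hypotheses (n2 : (2 <= n)%N) (k1 : (1 <= k)%N) (hsigma : is_sphere_measure sigma).
Variables (C : {fset 'rV[R]_n}) (y : 'rV[R]_n).
Hypotheses (hC : spherical_design sigma (2 * k) C) (yS : sphere y).
Implicit Types (p q : {poly R}) (l t : R).
Notation L := (zonal_mean sigma y).

Let LZ a p : L (a *: p) = a * L p.
Proof.
have L0 : L 0 = 0.
  by have := zonal_mean_scalar sigma y (-1) 0 0; rewrite scaler0 addr0 mulN1r addNr.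
by rewrite -[a *: p]addr0 zonal_mean_scalar L0 addr0.
Qed.

Let LB p q : L (p - q) = L p - L q.
Proof. by rewrite addrC -scaleN1r zonal_mean_scalar mulN1r addrC. Qed.

Lemma design_mean_eq0 p : (size p <= (2 * k).+1)%N -> L p = 0 ->
  (forall x, x \in C -> 0 <= p.[dot x y]) -> forall x, x \in C -> p.[dot x y] = 0.
Proof.
move=> pk Lp p0 x xC; have := design_mean y hC pk.
rewrite Lp => /eqP; rewrite mulf_eq0 invr_eq0 pnatr_eq0 cardfs_eq0.
(* The factor 1/|C| is 0 only for empty C, which x excludes. *)
case/orP; last by move/eqP => C0; rewrite C0 in_fset0 in xC.
rewrite big_seq psumr_eq0; last by move=> i /p0.
by move=> /allP /(_ x xC); rewrite xC /= => /eqP.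
Qed.

(** The degree of p^2 is at most 2k, so its average over C is its mean over the sphere, positive
    unless p = 0. *)
Lemma design_separates p : (size p <= k.+1)%N ->
  (forall x, x \in C -> p.[dot x y] = 0) -> p = 0.
Proof.
move=> pk p0; apply/eqP/negPn/negP => /(zonal_mean_sqr_gt0 n2 hsigma yS).
have p2k : (size (p ^+ 2) <= (2 * k).+1)%N.
  apply: (leq_trans (size_poly_exp_leq _ _)); rewrite ltnS mulnC leq_mul2l /=.
  by case: (size p) pk.
rewrite -(design_mean y hC p2k) big_seq big1 ?mul0r ?ltxx// => x /p0 px.
by rewrite horner_exp px expr0n.
Qed.

Let zonal_mean_orthogonal m p q : is_orthogonal_poly (int_mu n) m p ->
  (size q <= m)%N -> L (p * q) = 0.
Proof.
move=> [_ _ +] qm => /(_ q qm) pq; apply/eqP; rewrite -(int_mu_eq0 n2 hsigma _ yS).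
rewrite -[X in _ == X]pq; apply/eqP; congr int_mu.
by apply/funext => t; rewrite hornerM.
Qed.

Let size_comp_opp p : size (p \Po - 'X) = size p.
Proof. by rewrite size_comp_poly2// size_polyN size_polyX. Qed.

(** Both sides have degree m and the same leading coefficient, so their difference has degree below
    m. It is orthogonal to both, hence to itself. *)
Lemma orthogonal_poly_parity m p : is_orthogonal_poly (int_mu n) m p ->
  p = (-1) ^+ m *: (p \Po - 'X).
Proof.
move=> po; have [sp _ _] := po.
pose q : {poly R} := (-1) ^+ m *: (p \Po - 'X).
have sq : size q = m.+1 by rewrite size_scale ?signr_eq0// size_comp_opp.
have sd : (size (p - q)%R <= m)%N.
  apply/leq_sizeP => j; rewrite leq_eqVlt => /predU1P[<-|mj]; last first.
    by rewrite coefB !nth_default ?subrr ?sq ?sp.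
  have -> : (p - q)`_m = lead_coef p - lead_coef q.
    by rewrite coefB !lead_coefE sp sq.
  rewrite lead_coefZ lead_coef_comp ?size_polyN ?size_polyX//.
  rewrite lead_coefN lead_coefX sp /= mulrCA -exprMn mulrNN mulr1 expr1n mulr1.
  by rewrite subrr.
apply/eqP; rewrite -subr_eq0; apply/negPn/negP => /(zonal_mean_sqr_gt0 n2 hsigma yS).
rewrite expr2 mulrBl LB (zonal_mean_orthogonal po sd) -/q /q -scalerAl LZ.
(* Evenness of the mean moves the substitution t -> -t from p to the difference, whose degree it
   preserves. *)
rewrite -(zonal_mean_opp hsigma) rmorphM /= -comp_polyA rmorphN /= comp_polyX opprK comp_polyXr.
by rewrite (zonal_mean_orthogonal po) ?size_comp_opp// mulr0 subrr ltxx.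
Qed.

(** By parity the zeros are symmetric about 0, so the least zero z satisfies z <= -z; without zeros
    the default is 0. Below it yields l < 0. *)
Lemma gegenbauer_first_zero_le0 m : zero_of (gegenbauer R n m) 1 <= 0.
Proof.
rewrite /zero_of /gegenbauer /orthogonal_poly.
case: xgetP => [p _ po|_]; last by rewrite rootsR0.
have [sp _ _] := po; have p0 : p != 0 by rewrite -size_poly_gt0 sp.
have := sorted_roots (- cauchy_bound p) (cauchy_bound p) p.
rewrite -/(rootsR p); case E : (rootsR p) => [//|z s] /= zs.
have : - z \in rootsR p.
  rewrite mem_rootsR// rootE (orthogonal_poly_parity po) hornerZ horner_comp.
  rewrite hornerN hornerX opprK mulf_eq0 signr_eq0 /= -/(root p z).
  by rewrite -mem_rootsR// E mem_head.
rewrite E inE => /predU1P[|/(allP (order_path_min lt_trans zs))]; lra.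
Qed.

(** The signed measure mu_l is mu times -(t - l)/l, and the nonzero constant -1/l is divided out. *)
Lemma zonal_mean_orthogonal_mul l m p q : l != 0 ->
  is_orthogonal_poly (int_mul n l) m p -> (size q <= m)%N ->
  L (p * q * ('X - l%:P)) = 0.
Proof.
move=> l0 [_ _ +] qm => /(_ q qm) pq.
have : L ((- l^-1) *: (p * q * ('X - l%:P))) = 0.
  apply/eqP; rewrite -(int_mu_eq0 n2 hsigma _ yS) -[X in _ == X]pq; apply/eqP.
  by congr int_mu; apply/funext => t; rewrite hornerZ !hornerM hornerXsubC; ring.
by rewrite LZ => /eqP; rewrite mulf_eq0 oppr_eq0 invr_eq0 (negbTE l0) => /eqP.
Qed.

Lemma dot_le_max_dot x : x \in C -> dot x y <= max_dot C y.
Proof.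
move=> xC; apply: ub_le_sup; last by exists x.
exists (\sum_i `|y 0 i|) => _ [z /= zC <-].
by rewrite (le_trans (ler_norm _))// sphere_dot_le//; exact: hC.1.
Qed.

Lemma inner_value1_le x : x \in C -> inner_value C y 1 <= dot x y.
Proof.
move=> xC; rewrite /inner_value /=.
have : dot x y \in sort <=%R [seq dot x y | x <- C] by rewrite mem_sort; apply/mapP; exists x.
have := sort_le_sorted [seq dot x y | x <- C].
case: (sort _ _) => [//|a s] /= /(order_path_min le_trans) /allP aS.
by rewrite inE => /predU1P[->|/aS].
Qed.

(** If all <x, y> were negative, -X would be positive on C with mean 0. This bound handles the
    default value 0 of [zero_of]. *)
Lemma max_dot_ge0 : 0 <= max_dot C y.
Proof.
rewrite leNgt; apply/negP => m0.
have X0 : ('X : {poly R}) != 0 by rewrite polyX_eq0.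
have LX : L (- 'X) = 0.
  have := zonal_mean_opp hsigma y 'X; rewrite comp_polyX -scaleN1r LZ; lra.
apply/negP: X0; rewrite negbK; apply/eqP; apply: design_separates.
  by rewrite size_polyX ltnS.
move=> x xC; apply/eqP; rewrite -oppr_eq0 -hornerN; apply/eqP.
apply: design_mean_eq0 xC => //.
  by rewrite size_polyN size_polyX ltnS muln_gt0.
move=> z /dot_le_max_dot zm; rewrite hornerN hornerX; lra.
Qed.

(** Stated for an arbitrary zero s, so that the theorem only has to know that the k-th entry of the
    root list is a root. *)
Lemma max_dot_ge_root l s p : l != 0 -> l <= inner_value C y 1 ->
  is_orthogonal_poly (int_mul n l) k p -> root p s -> s <= max_dot C y.
Proof.
move=> l0 lC po /factor_theorem[q pq]; rewrite leNgt; apply/negP => ms.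
have [sp _ _] := po; have p0 : p != 0 by rewrite -size_poly_gt0 sp.
have q0 : q != 0 by apply: contraNneq p0 => q0; rewrite pq q0 mul0r.
have sqX a : size (q * ('X - a%:P))%R = (size q).+1.
  by rewrite size_mul ?polyXsubC_eq0// size_XsubC addn2.
have sq : size q = k by move: sp; rewrite pq sqX => -[].
have sl : size (('X - l%:P) * q)%R = k.+1 by rewrite mulrC sqX sq.
have ts x : x \in C -> dot x y < s by move=> /dot_le_max_dot /le_lt_trans; apply.
have Lf : L (- (p * q * ('X - l%:P))) = 0.
  by rewrite -scaleN1r LZ (zonal_mean_orthogonal_mul l0 po) ?mulr0// sq.
have sf : (size (- (p * q * ('X - l%:P)))%R <= (2 * k).+1)%N.
  rewrite size_polyN -mulrA [q * _]mulrC (leq_trans (size_polyMleq _ _))//.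
  by rewrite sp sl addSn addnS addnn mul2n.
have f0 := design_mean_eq0 sf Lf.
(* This product is nonzero of degree k, so its vanishing on C is the contradiction sought. *)
suff /eqP : ('X - l%:P) * q = 0 by rewrite mulf_eq0 polyXsubC_eq0 (negbTE q0).
apply: design_separates; first by rewrite sl.
(* With the sign changed, the test polynomial is nonnegative for l <= t < s. *)
have fE x : (- (p * q * ('X - l%:P))).[dot x y]
    = (dot x y - l) * (s - dot x y) * q.[dot x y] ^+ 2.
  by rewrite pq !(hornerN, hornerM, hornerXsubC); ring.
move=> x xC; have tx := ts x xC.
have /f0 : forall x, x \in C -> 0 <= (- (p * q * ('X - l%:P))).[dot x y].
  move=> z zC; rewrite fE; apply: mulr_ge0; last exact: sqr_ge0.
  by rewrite mulr_ge0 ?subr_ge0 ?(le_trans lC) ?inner_value1_le// ltW ?ts.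
move=> /(_ x xC) /eqP; rewrite fE hornerM hornerXsubC.
(* The strict bound t < s removes the factor s - t, leaving t = l or q(t) = 0. *)
rewrite mulf_eq0 sqrf_eq0 mulf_eq0 [s - _ == 0]subr_eq0 (gt_eqF tx) orbF.
by move=> /orP[]/eqP ->; rewrite ?mul0r ?mulr0.
Qed.

End DesignInequality.

Theorem theorem4p1 (R : realType) (n k : nat) (hn : (2 <= n)%N) (hk : (1 <= k)%N)
  (sigma : probability (borel_rV R n) R) (hsigma : is_sphere_measure sigma)
  (C : {fset 'rV[R]_n}) (hC : spherical_design sigma (2 * k) C)
  (hspan : spans C)
  (y : 'rV[R]_n) (hy : realizes_covering_radius C y)
  (l : R) (hl1 : -1 < l) (hl2 : l < zero_of (gegenbauer R n k) 1)
  (hl3 : (gegenbauer R n k.+1).[l] <> (gegenbauer R n k).[l])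
  (hl4 : l <= inner_value C y 1) :
  zero_of (gegenbauer0 n l k) k <= rho C.
Proof.
have [yS <-] := hy.
(* The least zero of the Gegenbauer polynomial is at most 0, so l < 0 and the inverse in mu_l is a
   true one. *)
have l0 : l != 0 by rewrite lt_eqF// (lt_le_trans hl2)// (gegenbauer_first_zero_le0 hn hsigma yS).
have m0 := max_dot_ge0 hn hk hsigma hC yS.
rewrite /zero_of /gegenbauer0 /orthogonal_poly.
(* The default 0 arises in two ways: [xget] finds no polynomial, or the root list has fewer than k
   entries. Both are settled by [m0]. *)
case: xgetP => [p _ po|_]; last by rewrite rootsR0 nth_nil.
have [kp|kp] := ltnP k.-1 (size (rootsR p)); last by rewrite nth_default.
apply: (max_dot_ge_root hn hsigma hC yS l0 hl4 po).
rewrite -mem_rootsR ?mem_nth//.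
by have [sp _ _] := po; rewrite -size_poly_gt0 sp.
Qed.
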